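(* Let $d\ge 1$, $0\le n\le m\le N$ be integers and $\kappa\in\mathbb{R}^{d+1}$ with all $\kappa_i>-1$. Then for all $f\in\mathcal V_n^d(\mathsf H_{\kappa,N})$ and $x\in\mathbb Z_N^{d+1}$, $$f(x)=\mathsf D_n(m,N)\sum_{\alpha\in\mathbb Z_m^{d+1}}\frac{(\kappa+\mathbf 1)_\alpha}{\alpha!}\,\big\langle f,\mathsf Q_{\alpha,n}(\cdot;\kappa,N)\big\rangle_{\mathsf H_{\kappa,N}}\,\mathsf Q_{\alpha,n}(x;\kappa,N).$$ Furthermore, $\{\mathsf Q_{\alpha,n}(\cdot;\kappa,N):|\alpha|=m\}$ is a tight frame of $\mathcal V_n^d(\mathsf H_{\kappa,N})$, in the sense that for all $f\in\mathcal V_n^d(\mathsf H_{\kappa,N})$ $$\langle f,f\rangle_{\mathsf H_{\kappa,N}}=\mathsf D_n(m,N)\sum_{\alpha\in\mathbb Z_m^{d+1}}\frac{(\kappa+\mathbf 1)_\alpha}{\alpha!}\,\big\langle f,\mathsf Q_{\alpha,n}(\cdot;\kappa,N)\big\rangle_{\mathsf H_{\kappa,N}}^2 .$$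
   Context: Notation: $(a)_n=a(a+1)\cdots(a+n-1)$, $(a)_0=1$; for vectors, $|y|$ is the sum of the components, $\alpha!=\prod_i\alpha_i!$, $(y)_\alpha=\prod_i(y_i)_{\alpha_i}$; $\mathbf 1=(1,\dots,1)\in\mathbb R^{d+1}$. $\mathbb Z_N^{d+1}=\{\alpha\in\mathbb N_0^{d+1}:|\alpha|=N\}$. Inner product: $\langle f,g\rangle_{\mathsf H_{\kappa,N}}=\frac{N!}{(|\kappa|+d+1)_N}\sum_{x\in\mathbb Z_N^{d+1}}f(x)g(x)\frac{(\kappa+\mathbf 1)_x}{x!}$. $\Pi_n^d$ is the space of polynomials of total degree at most $n$ in $x_1,\dots,x_d$ ($\Pi_{-1}^d=\{0\}$), regarded as functions on $\mathbb Z_N^{d+1}$ (where $x_{d+1}=N-x_1-\cdots-x_d$); polynomials in $x_1,\dots,x_{d+1}$ are regarded as functions on $\mathbb Z_N^{d+1}$ in the same way. For $0\le n\le N$, $\mathcal V_n^d(\mathsf H_{\kappa,N})$ is the space of $p\in\Pi_n^d$ orthogonal to $\Pi_{n-1}^d$ under $\langle\cdot,\cdot\rangle_{\mathsf H_{\kappa,N}}$. Let $\mathrm m_\alpha(x)=(-1)^{|\alpha|}(-x)_\alpha$ for $\alpha\in\mathbb N_0^{d+1}$, and for $n\le|\alpha|\le N$ let $\mathsf Q_{\alpha,n}(\cdot;\kappa,N)=\frac{1}{(\kappa+\mathbf 1)_\alpha}\,\mathrm{proj}_{\mathcal V_n^d(\mathsf H_{\kappa,N})}\mathrm m_\alpha$,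 where $\mathrm{proj}$ is the orthogonal projection of $\Pi_N^d$ onto $\mathcal V_n^d(\mathsf H_{\kappa,N})$. Finally $$\mathsf D_n(m,N)=\frac{(-N)_n\,m!\,(|\kappa|+d+1)_N\,(|\kappa|+d+1)_{m+n}}{(-m)_n\,[(-N)_m]^2\,(|\kappa|+d+1)_{N+n}}.$$ *)

(* Defs.v *)
From HB Require Import structures.
From mathcomp Require Export all_boot all_order all_algebra.
From mathcomp Require Export mpoly.

Set Implicit Arguments.
Unset Strict Implicit.
Unset Printing Implicit Defensive.

Import Order.TTheory GRing.Theory Num.Theory.
Local Open Scope ring_scope.

Definition poch (R : nzRingType) (a : R) (n : nat) : R :=
  \prod_(i < n) (a + i%:R).

Definition mpoch (R : nzRingType) (k : nat) (y : 'I_k -> R) (a : 'X_{1..k}) : R :=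
  \prod_(i < k) poch (y i) (a i).

Definition mfact (k : nat) (a : 'X_{1..k}) : nat := (\prod_(i < k) (a i)`!)%N.

(* Z_N^{d+1} is [simplex d.+1 N]; the bound N.+1 only serves finiteness. *)
Definition simplex (k N : nat) := {x : 'X_{1..k < N.+1} | mdeg x == N}.

Definition simplex_mnm (k N : nat) (x : simplex k N) : 'X_{1..k} := bmnm (val x).
Coercion simplex_mnm : simplex >-> multinom.

(* [R^o] rather than [R], so that functions inherit a vector space structure. *)
Definition latfun (R : realFieldType) (d N : nat) := {ffun simplex d.+1 N -> R^o}.

Section HahnInnerProduct.
Variables (R : realFieldType) (d N : nat) (kappa : 'I_d.+1 -> R).
Implicit Types f g : latfun R d N.

Definition ksum : R := \sum_(i < d.+1) kappa i.

Definition kappa1 (i : 'I_d.+1) : R := kappa i + 1.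

Definition hahn_dot f g : R :=
  (N`!)%:R / poch (ksum + d.+1%:R) N *
  \sum_(x : simplex d.+1 N) f x * g x * (mpoch kappa1 x / (mfact x)%:R).

Fact hahn_dotC f g : hahn_dot f g = (-1) ^+ false * idfun (hahn_dot g f).
Proof.
rewrite expr0 mul1r /hahn_dot /=; congr (_ * _).
by apply: eq_bigr => x _; rewrite [f x * _]mulrC.
Qed.

Fact hahn_dotPl g : linear_for *%R (hahn_dot^~ g).
Proof.
move=> a f h; rewrite /hahn_dot mulrCA -mulrDr; congr (_ * _).
rewrite mulr_sumr -big_split /=; apply: eq_bigr => x _.
by rewrite !ffunE !mulrDl !mulrA.
Qed.

Fact hahn_dot_bilinear :
  bilinear_for (GRing.Scale.Law.clone _ _ *%R _)
    (GRing.Scale.Law.clone _ _ (idfun \; *%R) _) hahn_dot.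
Proof.
split=> [g | f] a u v; first exact: hahn_dotPl.
by rewrite !(hahn_dotC f) expr0 !mul1r hahn_dotPl.
Qed.

HB.instance Definition _ :=
  bilinear_isBilinear.Build R (latfun R d N) (latfun R d N) R _ _
    hahn_dot hahn_dot_bilinear.
HB.instance Definition _ :=
  isHermitianSesquilinear.Build R (latfun R d N) false idfun hahn_dot hahn_dotC.

Fact hahn_dot_eq0 (kappa_gt : forall i, -1 < kappa i) f :
  hahn_dot f f = 0 -> f = 0.
Proof.
have k1_gt0 i : 0 < kappa1 i by rewrite /kappa1 -ltrBlDr sub0r.
have poch_gt0 (a : R) n : 0 < a -> 0 < poch a n.
  by move=> a0; apply: prodr_gt0 => i _; rewrite ltr_wpDr ?ler0n.
have s_gt0 : 0 < ksum + d.+1%:R.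
  rewrite /ksum -[d.+1 in X in _ < _ + X]card_ord -sum1_card natr_sum -big_split /=.
  rewrite big_ord_recl ltr_wpDr ?k1_gt0 // sumr_ge0 // => i _.
  exact/ltW/k1_gt0.
have w_gt0 (x : simplex d.+1 N) : 0 < mpoch kappa1 x / (mfact x)%:R.
  rewrite divr_gt0 //; first by apply: prodr_gt0 => i _; apply: poch_gt0.
  by rewrite ltr0n; apply: prodn_gt0 => i; rewrite fact_gt0.
move=> /eqP; rewrite mulf_eq0 gt_eqF /=; last first.
  by rewrite divr_gt0 ?poch_gt0 // ltr0n fact_gt0.
rewrite psumr_eq0 => [/allP f0|x _]; last first.
  by rewrite mulr_ge0 ?(ltW (w_gt0 x)) // -expr2 sqr_ge0.
apply/ffunP => x; rewrite ffunE; have := f0 x (mem_index_enum x).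
by rewrite /= mulf_eq0 (gt_eqF (w_gt0 x)) orbF mulf_eq0 orbb => /eqP.
Qed.

End HahnInnerProduct.

Section PolynomialSpaces.
Variables (R : realFieldType) (d N : nat).

(* The d variables are the first d entries of the lattice point; the last one,
   N minus their sum, is redundant. *)
Definition polyfun (p : {mpoly R[d]}) : latfun R d N :=
  [ffun x : simplex d.+1 N =>
     p.@[fun i : 'I_d => (x (widen_ord (leqnSn d) i))%:R]].

(* The bound is strict, as for [msize]: the space of polynomials of total
   degree at most n is [polyspace n.+1], and the one of degree at most n - 1 is
   [polyspace n], which is 0 for n = 0. *)
Definition polyspace (k : nat) : {vspace latfun R d N} :=
  <<[seq polyfun 'X_[m] | m : 'X_{1..d < k}]>>%VS.

Fact polyfun_is_linear : linear polyfun.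
Proof. by move=> a p q; apply/ffunP => x; rewrite !ffunE mevalD mevalZ. Qed.

HB.instance Definition _ :=
  GRing.isLinear.Build R {mpoly R[d]} (latfun R d N) _ polyfun polyfun_is_linear.

Lemma mem_polyspace k (f : latfun R d N) :
  (f \in polyspace k) <-> exists2 p : {mpoly R[d]}, (msize p <= k)%N & f = polyfun p.
Proof.
split=> [|[p sp ->]].
  rewrite /polyspace; set s := [seq _ | m : _].
  have: {in s, forall g, exists2 p : {mpoly R[d]}, (msize p <= k)%N & g = polyfun p}.
    move=> g /mapP[m _ ->]; exists 'X_[m] => //.
    by rewrite msizeX bmdeg.
  elim: s f => [|g s IHs] f Ps.
    by rewrite span_nil memv0 => /eqP->; exists 0; rewrite ?msize0 // linear0.
  rewrite span_cons => /memv_addP[u /vlineP[c ->] [v vs ->]].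
  have [|p sp ->] := IHs v _ vs; first by move=> h hs; apply: Ps; rewrite inE hs orbT.
  have [q sq ->] := Ps g (mem_head _ _).
  exists (c *: q + p); last by rewrite linearP.
  rewrite (leq_trans (msizeD_le _ _)) // geq_max sp andbT.
  exact: leq_trans (msizeZ_le _ _) sq.
rewrite (mpolyE p) linear_sum big_seq memv_suml // => m mp.
rewrite linearZ memvZ // memv_span //.
have lt_mk : (mdeg m < k)%N by apply: leq_trans (msize_mdeg_lt mp) sp.
by apply/mapP; exists (BMultinom lt_mk); rewrite ?mem_enum.
Qed.

End PolynomialSpaces.

Section HahnSpaces.
Variables (R : realFieldType) (d N : nat) (kappa : 'I_d.+1 -> R).
Implicit Types (f g : latfun R d N) (V : {vspace latfun R d N}).

Definition hahn_orth V : {vspace latfun R d N} := orthov (@hahn_dot R d N kappa) V.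

Definition hahnV (n : nat) : {vspace latfun R d N} :=
  (polyspace R d N n.+1 :&: hahn_orth (polyspace R d N n))%VS.

(* [daddv_pi U W] is only meaningful when U and W are disjoint, which holds
   here as soon as the form is definite, see [hahn_projP]. *)
Definition hahn_proj V : 'End(latfun R d N) := daddv_pi V (hahn_orth V).

Lemma mem_hahnV n f :
  (f \in hahnV n) <->
  f \in polyspace R d N n.+1 /\
  {in polyspace R d N n, forall g, hahn_dot kappa f g = 0}.
Proof.
by rewrite memv_cap; split=> [/andP[-> /mem_orthovP]|[-> /mem_orthovP]].
Qed.

Lemma hahn_projP (kappa_gt : forall i, -1 < kappa i) V f :
  hahn_proj V f \in V /\
  {in V, forall g, hahn_dot kappa (f - hahn_proj V f) g = 0}.
Proof.
split; first exact: memv_pi.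
have tV : (V :&: hahn_orth V = 0)%VS.
  apply/eqP; rewrite -subv0; apply/subvP => u /memv_capP[uV /mem_orthovP uO].
  by rewrite memv0; apply/eqP/(hahn_dot_eq0 kappa_gt)/uO.
suff fV : f \in (V + hahn_orth V)%VS.
  move=> g gV; rewrite -{1}(daddv_pi_add tV fV) addrAC subrr add0r.
  by have /mem_orthovP -> := memv_pi (hahn_orth V) V f.
suff -> : (V + hahn_orth V = fullv)%VS by apply: memvf.
apply/eqP; rewrite eqEdim subvf dimv_disjoint_sum // /=.
have capP k (F : 'I_k -> 'Hom(latfun R d N, R^o)) :
    (\dim (fullv : {vspace latfun R d N})
       <= k + \dim (\bigcap_(i < k) lker (F i))%VS)%N.
  elim: k F => [|k IHk] F; first by rewrite big_ord0.
  rewrite big_ord_recr /=; set W := (\bigcap_(i < k) _)%VS.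
  apply: leq_trans (IHk (fun i => F (widen_ord (leqnSn k) i))) _.
  rewrite addSnnS leq_add2l -(limg_ker_dim (F ord_max) W) -/W addnC.
  rewrite -[X in (_ <= X)%N]add1n.
  rewrite leq_add2r.
  by have := dimvS (subvf (F ord_max @: W)); rewrite dimvf.
exact: capP.
Qed.

(* (-x)_a is the rising factorial of the negated entries, so up to the sign it is
   the product of the falling factorials x_i (x_i - 1) ... (x_i - a_i + 1). *)
Definition mfun (a : 'X_{1..d.+1}) : latfun R d N :=
  [ffun x : simplex d.+1 N =>
     (-1) ^+ mdeg a * mpoch (fun i => - (x i)%:R) a].

Definition hahnQ (n : nat) (a : 'X_{1..d.+1}) : latfun R d N :=
  (mpoch (kappa1 kappa) a)^-1 *: hahn_proj (hahnV n) (mfun a).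

Definition hahnD (n m : nat) : R :=
  (poch (- N%:R) n * (m`!)%:R * poch (ksum kappa + d.+1%:R) N
     * poch (ksum kappa + d.+1%:R) (m + n))
  / (poch (- m%:R) n * (poch (- N%:R) m) ^+ 2
     * poch (ksum kappa + d.+1%:R) (N + n)).

End HahnSpaces.

Arguments hahnV {R d} N kappa n.
Arguments hahnQ {R d} N kappa n a.
Arguments hahnD {R d} N kappa n m.

(* Main.v *)
(** For [f] in [V_n], the number [<f, Q_a>] is the value at [a] of [urn m f], a
  function on the lattice points of degree [m], and the sum over [a] in the
  statement is the projection on [V_n] of [sampling N (urn m f)].  Both operators
  are explicit on suitable bases, by Chu-Vandermonde: [urn] multiplies
  [(kappa + 1 + x)_b] by a constant depending only on [|b|], and [sampling]
  does the same with [m_b].  Since both families have leading monomial [x^b],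
  the composite acts on polynomials of degree at most [n], modulo those of
  degree less than [n], as a scalar, which turns out to be [1 / D_n(m, N)]; the
  projection on [V_n] kills the lower order part. *)
From HB Require Import structures.
From mathcomp Require Import ring.
Require Import Defs.

Set Implicit Arguments.
Unset Strict Implicit.
Unset Printing Implicit Defensive.

Import Order.TTheory GRing.Theory Num.Theory.
Local Open Scope ring_scope.

(** * Multi-indices and Pochhammer symbols *)

Lemma mnm_ind k (P : 'X_{1..k} -> Prop) :
  P 0%MM -> (forall b i, P b -> P (b + U_(i))%MM) -> forall b, P b.
Proof.
move=> P0 PS b; have [n] := ubnP (mdeg b); elim: n b => // n IHn b ltbn.
have [->//|] := eqVneq b 0%MM; rewrite -mdeg_eq0 mdegE sum_nat_eq0 negb_forall.
case/existsP=> i /= bi; have lei : (U_(i) <= b)%MM.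
  by apply/mnm_lepP=> j; rewrite mnm1E; case: eqP => // <-; rewrite lt0n.
rewrite -(submK lei); apply: PS; apply: IHn.
by move: ltbn; rewrite -{1}(submK lei) mdegD mdeg1 addn1.
Qed.

Section Pochhammer.
Variable R : comNzRingType.
Implicit Types a : R.

Lemma poch0 a : poch a 0 = 1.
Proof. by rewrite /poch big_ord0. Qed.

Lemma pochS a n : poch a n.+1 = poch a n * (a + n%:R).
Proof. by rewrite /poch big_ord_recr. Qed.

Lemma pochD a m n : poch a (m + n) = poch a m * poch (a + m%:R) n.
Proof.
elim: n => [|n IHn]; first by rewrite addn0 poch0 mulr1.
by rewrite addnS !pochS IHn natrD addrA mulrA.
Qed.

(** The factor [p!] clears the denominator of $(p+q)!/p!$, so the identity holds in any commutative
    ring. *)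
Lemma pochN_fact p q :
  (p`!)%:R * poch (- (p + q)%:R) q = (-1) ^+ q * ((p + q)`!)%:R :> R.
Proof.
elim: q => [|q IHq]; first by rewrite addn0 poch0 mulr1 expr0 mul1r.
rewrite addnS /poch big_ord_recl /= addr0 factS natrM exprS.
rewrite (_ : \prod_(i < q) _ = poch (- (p + q)%:R) q); last first.
  apply: eq_bigr => i _; rewrite /= /bump /= -(addn1 (p + q)) natrD opprD.
  by rewrite -addrA [X in _ + (_ + X)]natrD addKr.
by rewrite mulrCA IHq mulN1r !mulNr mulrCA.
Qed.

Lemma pochN_eq0 p q : (p < q)%N -> poch (- p%:R : R) q = 0.
Proof. by move=> lt_pq; rewrite /poch (bigD1 (Ordinal lt_pq)) //= addNr mul0r. Qed.

Section Multi.
Variable k : nat.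
Implicit Types (y : 'I_k -> R) (b c : 'X_{1..k}).

Lemma mpoch0 y : mpoch y 0%MM = 1.
Proof. by rewrite /mpoch big1 // => i _; rewrite mnm0E poch0. Qed.

Lemma mpochD y b c :
  mpoch y (b + c)%MM = mpoch y b * mpoch (fun i => y i + (b i)%:R) c.
Proof.
by rewrite /mpoch -big_split /=; apply: eq_bigr => i _; rewrite mnmDE pochD.
Qed.

Lemma mpochU y i : mpoch y U_(i)%MM = y i.
Proof.
rewrite /mpoch (bigD1 i) //= mnm1E eqxx pochS poch0 mul1r addr0 big1 ?mulr1 //.
by move=> j ji; rewrite mnm1E eq_sym (negPf ji) poch0.
Qed.

End Multi.
End Pochhammer.

(** * Lattice points of fixed degree and sums over them *)

Lemma mdeg_simplex k N (x : simplex k N) : mdeg x = N.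
Proof. exact/eqP/(valP x). Qed.

Lemma simplex_inj k N : injective (@simplex_mnm k N).
Proof. by move=> x y e; apply/val_inj/val_inj. Qed.

Lemma simplex_exists k N (a : 'X_{1..k}) :
  mdeg a = N -> {x : simplex k N | x = a :> 'X_{1..k}}.
Proof.
move=> aN; have lt_aN : (mdeg a < N.+1)%N by rewrite aN.
have aN' : mdeg (BMultinom lt_aN) == N by rewrite /= aN.
by exists (exist _ (BMultinom lt_aN) aN').
Qed.

Section SimplexSums.
Variables (R : realFieldType) (k : nat).
Implicit Types (a : 'X_{1..k}) (F : 'X_{1..k} -> R).

(** Same formula as [mfun], but at an arbitrary point: a lattice point can then serve as the
    argument of one factor and the index of another. *)
Definition mfalling a (x : 'I_k -> R) : R :=
  (-1) ^+ mdeg a * mpoch (fun i => - x i) a.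

Lemma mfact_neq0 a : (mfact a)%:R != 0 :> R.
Proof. by rewrite pnatr_eq0 -lt0n; apply: prodn_gt0 => i; rewrite fact_gt0. Qed.

Lemma mfalling_prod a x : mfalling a x = \prod_i ((-1) ^+ a i * poch (- x i) (a i)).
Proof. by rewrite /mfalling mdegE expr_sum -big_split. Qed.

Lemma mfalling_mfact a b :
  mfalling a (fun i => ((a + b)%MM i)%:R) / (mfact (a + b))%:R = (mfact b)%:R^-1.
Proof.
suff e : (mfact (a + b))%:R = (mfact b)%:R * mfalling a (fun i => ((a + b)%MM i)%:R).
  have := mfact_neq0 (a + b); rewrite e mulf_eq0 negb_or => /andP[_ nz].
  by rewrite invfM mulrCA divff ?mulr1.
rewrite mfalling_prod /mfact !natr_prod -big_split /=; apply: eq_bigr => i _.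
by rewrite mnmDE addnC mulrCA pochN_fact mulrA -exprD addnn -signr_odd odd_double mul1r.
Qed.

Lemma mfalling_eq0 a (x : 'X_{1..k}) :
  ~~ (a <= x)%MM -> mfalling a (fun i => (x i)%:R) = 0.
Proof.
case/forallPn=> i; rewrite -ltnNge => lt_xa; rewrite mfalling_prod.
by rewrite (bigD1 i) //= pochN_eq0 // mulr0 mul0r.
Qed.

(** The falling factorial vanishes unless $a \le x$; for $x = a + y$ it turns $1/x!$ into $1/y!$.
    Both [urn] and [sampling] are computed through this shift. *)
Lemma sum_mfalling a M N F : N = (mdeg a + M)%N ->
  \sum_(x : simplex k N) mfalling a (fun i => (x i)%:R) / (mfact x)%:R * F x =
  \sum_(y : simplex k M) F (a + y)%MM / (mfact y)%:R.
Proof.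
move=> eN; have shift (y : simplex k M) : {x : simplex k N | x = (a + y)%MM :> 'X_{1..k}}.
  by apply: simplex_exists; rewrite mdegD mdeg_simplex.
pose h y := sval (shift y); have hE y : h y = (a + y)%MM :> 'X_{1..k} := svalP (shift y).
rewrite (bigID (fun x : simplex k N => (a <= x)%MM)) /= [X in _ + X]big1 ?addr0; last first.
  by move=> x /mfalling_eq0 ->; rewrite !mul0r.
(* The shift [h] has only a partial inverse, defined where $a \le x$ by $y = x - a$. *)
rewrite (reindex_omap h (fun x : simplex k N => [pick y | h y == x])) => [|x le_ax]; last first.
  case: pickP => [y /eqP <- //|] no_y.
  have [|y yE] := simplex_exists (N := M) (a := (simplex_mnm x - a)%MM).
    by apply: (@addIn (mdeg a)); rewrite -mdegD submK // mdeg_simplex eN addnC.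
  by have /eqP[] := no_y y; apply: simplex_inj; rewrite hE yE addmC submK.
apply: eq_big => [y|y _]; last first.
  rewrite hE mulrC; congr (_ * _); exact: mfalling_mfact.
rewrite hE lem_addr //=; case: pickP => [z /eqP e|/(_ y)]; last by rewrite eqxx.
apply/eqP; congr Some; apply: simplex_inj.
by apply: (@addmI _ a); rewrite -!hE e.
Qed.

(* Chu-Vandermonde: weighing each term by the degree of [x] splits the sum into
   the contributions of the coordinates, each one a shift of the sum in degree
   one less. *)
Lemma sum_mpoch (b : 'I_k -> R) N :
  \sum_(x : simplex k N) mpoch b x / (mfact x)%:R = poch (\sum_i b i) N / (N`!)%:R.
Proof.
elim: N => [|N IHN].
  have [x0 x0E] := simplex_exists (@mdeg0 k).
  rewrite (bigD1 x0) //= big1 => [|x /eqP[]].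
    by rewrite x0E mpoch0 poch0 fact0 addr0 /mfact big1 // => i _; rewrite mnm0E.
  by apply: simplex_inj; rewrite x0E; apply/eqP; rewrite -mdeg_eq0 mdeg_simplex.
have nzN p : p.+1%:R != 0 :> R by rewrite pnatr_eq0.
apply: (mulfI (nzN N)); rewrite factS natrM invfM mulrCA [RHS]mulrA.
rewrite [RHS]mulrA mulfK ?nzN // pochS.
transitivity (\sum_i \sum_(x : simplex k N.+1)
    mfalling U_(i)%MM (fun j => (simplex_mnm x j)%:R) / (mfact x)%:R * mpoch b x).
  rewrite exchange_big /= mulr_sumr; apply: eq_bigr => x _.
  rewrite -mulr_suml -mulr_suml [mpoch b _ / _]mulrC mulrA; congr (_ / _ * _).
  rewrite -[in LHS](mdeg_simplex x) mdegE natr_sum; apply: eq_bigr => i _.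
  by rewrite /mfalling mdeg1 mpochU mulN1r opprK.
transitivity (\sum_i \sum_(x : simplex k N) mpoch b (simplex_mnm x + U_(i))%MM / (mfact x)%:R).
  by apply: eq_bigr => i _; rewrite (sum_mfalling (M := N)) ?mdeg1 //; under eq_bigr do rewrite addmC.
rewrite exchange_big /= mulrAC -IHN mulr_suml; apply: eq_bigr => x _.
rewrite -mulr_suml [RHS]mulrAC; congr (_ / _).
move: (simplex_mnm x) (mdeg_simplex x) => a aN.
rewrite (eq_bigr (fun i => mpoch b a * (b i + (a i)%:R))) => [|i _].
  by rewrite -mulr_sumr big_split /= -natr_sum -mdegE aN.
by rewrite mpochD mpochU.
Qed.

End SimplexSums.

(** * Families of polynomials with leading monomials $x^b$ *)

Section MonicFamilies.
Variables (R : realFieldType) (d N : nat).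
Implicit Types (f : latfun R d N) (P Q : 'X_{1..d.+1} -> latfun R d N).
Implicit Types (b : 'X_{1..d.+1}).

Lemma polyspaceS j k : (j <= k)%N -> (polyspace R d N j <= polyspace R d N k)%VS.
Proof.
move=> le_jk; apply/subvP => f /mem_polyspace[p sp ->].
by apply/mem_polyspace; exists p => //; apply: leq_trans sp le_jk.
Qed.

Definition coord_mul (i : 'I_d.+1) (c : R) f : latfun R d N :=
  [ffun x : simplex d.+1 N => ((x i)%:R + c) * f x].

Lemma coord_mul_polyspace i c f k :
  f \in polyspace R d N k -> coord_mul i c f \in polyspace R d N k.+1.
Proof.
have mulP (q p : {mpoly R[d]}) :
    (msize q <= 2 -> msize p <= k -> polyfun N (q * p) \in polyspace R d N k.+1)%N.
  move=> sq sp; apply/mem_polyspace; exists (q * p) => //.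
  have [->|q0] := eqVneq q 0; first by rewrite mul0r msize0.
  have [->|p0] := eqVneq p 0; first by rewrite mulr0 msize0.
  by rewrite msizeM // -subn1 leq_subLR; apply: (leq_add sq sp).
case/mem_polyspace=> p sp ->.
(* Every coordinate is an affine polynomial in the first [d] ones; the last is $N$ minus their
   sum. *)
suff [q sq qE] : exists2 q : {mpoly R[d]}, (msize q <= 2)%N &
    forall x : simplex d.+1 N, q.@[fun j => (x (widen_ord (leqnSn d) j))%:R] = (x i)%:R + c.
  suff -> : coord_mul i c (polyfun N p) = polyfun N (q * p) by apply: mulP.
  by apply/ffunP=> x; rewrite !ffunE mevalM qE.
have sX j : (msize ('X_j : {mpoly R[d]}) <= 2)%N by rewrite msizeX mdeg1.
have sC (e : R) : (msize (e%:MP_[d]) <= 2)%N.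
  by rewrite msizeC; case: (_ != _).
have sD (p1 p2 : {mpoly R[d]}) : (msize p1 <= 2 -> msize p2 <= 2 -> msize (p1 + p2) <= 2)%N.
  by move=> s1 s2; rewrite (leq_trans (msizeD_le _ _)) // geq_max s1.
case: (unliftP ord_max i) => [j|] ->.
  exists ('X_j + c%:MP) => [|x]; first exact: sD.
  rewrite mevalD mevalC mevalXU; congr (_%:R + _); congr (simplex_mnm x _).
  by apply: val_inj; rewrite /= /bump leqNgt ltn_ord.
exists ((N%:R + c)%:MP - \sum_j 'X_j) => [|x].
  apply: (sD) => //; rewrite msizeN; elim/big_ind: _ => //; by rewrite msize0.
rewrite mevalB mevalC (big_morph _ (mevalD _) (meval0 _)).
rewrite (eq_bigr _ (fun j _ => mevalXU _ j)).
rewrite -[N in N%:R](mdeg_simplex x) mdegE big_ord_recr /= natrD natr_sum.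
by rewrite addrAC [_ - _]addrC addrA addNr add0r.
Qed.

(** Recursive encoding of the leading monomial $x^b$ in all [d.+1] coordinates: each step multiplies
    by some $x_i + c$, where [c] may depend on [b] and [i]. This avoids leading coefficients, which
    are ambiguous for functions on the lattice. *)
Definition monic_family P :=
  P 0%MM = [ffun=> 1] /\ forall b i, exists c, P (b + U_(i))%MM = coord_mul i c (P b).

Lemma monic_mem P b : monic_family P -> P b \in polyspace R d N (mdeg b).+1.
Proof.
case=> P0 PS; elim/mnm_ind: b => [|b i IHb].
  apply/mem_polyspace; exists 1; rewrite ?mdeg0 ?msize1 //.
  by rewrite P0; apply/ffunP=> x; rewrite !ffunE meval1.
have [c ->] := PS b i; rewrite mdegD mdeg1 addn1; exact: coord_mul_polyspace.
Qed.

(** In the inductive step, $x_i$ multiplies a difference of lower degree, and the constants add only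
    $c P_b - e Q_b$, of degree at most $|b|$. *)
Lemma monic_sub P Q b : monic_family P -> monic_family Q ->
  P b - Q b \in polyspace R d N (mdeg b).
Proof.
move=> mP mQ; elim/mnm_ind: b => [|b i IHb].
  by rewrite mP.1 mQ.1 subrr mem0v.
have [[_ /(_ b i) [c ->]] [_ /(_ b i) [e ->]]] := (mP, mQ).
have -> : coord_mul i c (P b) - coord_mul i e (Q b) =
    coord_mul i 0 (P b - Q b) + (c *: P b - e *: Q b).
  apply/ffunP=> x; rewrite !ffunE !mulrDl mul0r addr0 mulrBr opprD.
  by rewrite addrACA.
rewrite mdegD mdeg1 addn1 memvD ?coord_mul_polyspace //.
by rewrite memvB // memvZ // monic_mem.
Qed.

Lemma monomial_monic :
  monic_family (fun b => [ffun x : simplex d.+1 N => \prod_i (x i)%:R ^+ b i]).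
Proof.
split=> [|b i].
  by apply/ffunP=> x; rewrite !ffunE big1 // => i _; rewrite mnm0E expr0.
exists 0; apply/ffunP=> x; rewrite !ffunE addr0.
under eq_bigr do rewrite mnmDE exprD; rewrite big_split /= mulrC; congr (_ * _).
rewrite (bigD1 i) //= mnm1E eqxx expr1 big1 ?mulr1 // => j ji.
by rewrite mnm1E eq_sym (negPf ji) expr0.
Qed.

(** Triangularity: a monomial differs from the member of the family with the same exponent by terms
    of lower degree, which lie in [V] by induction. *)
Lemma monic_span P k (V : {vspace latfun R d N}) : monic_family P ->
  (forall b, (mdeg b < k)%N -> P b \in V) -> (polyspace R d N k <= V)%VS.
Proof.
move=> mP; elim: k => [|k IHk] PV.
  by apply/span_subvP => f /mapP[m]; have := bmdeg m; rewrite ltn0.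
have {}IHk : (polyspace R d N k <= V)%VS.
  by apply: IHk => b lt_bk; apply: PV; apply: leqW.
apply/span_subvP => _ /mapP[m _ ->].
(* Exponent 0 for the redundant last coordinate. *)
set b := mnmwiden m.
have degb : (mdeg b <= k)%N.
  suff -> : mdeg b = mdeg m by rewrite -ltnS bmdeg.
  rewrite !mdegE big_ord_recr /= mnmwiden_ordmax addn0.
  by apply: eq_bigr => i _; rewrite mnmwiden_widen.
have -> : polyfun N 'X_[R, m] = [ffun x : simplex d.+1 N => \prod_i (x i)%:R ^+ b i].
  apply/ffunP=> x; rewrite !ffunE mevalX big_ord_recr /= mnmwiden_ordmax expr0 mulr1.
  by apply: eq_bigr => i _; rewrite mnmwiden_widen.
rewrite -[X in X \in _](subrK (P b)) memvD ?PV //.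
apply: (subvP IHk); apply: (subvP (polyspaceS degb)).
exact: monic_sub monomial_monic mP.
Qed.

End MonicFamilies.

(** * The operators [sampling] and [urn], and their composite *)

Section RaisingLowering.
Variables (R : realFieldType) (d : nat).
Implicit Types (b : 'X_{1..d.+1}).

Lemma mfun_monic N : monic_family (@mfun R d N).
Proof.
split=> [|b i].
  by apply/ffunP=> x; rewrite !ffunE mdeg0 mpoch0 mulr1.
exists (- (b i)%:R); apply/ffunP=> x; rewrite !ffunE mdegD mdeg1 addn1 exprS.
by rewrite mpochD mpochU [- _ + _]addrC -opprB !mulrN mulN1r mulNr opprK mulrA mulrC.
Qed.

Definition mrising N (y : 'I_d.+1 -> R) b : latfun R d N :=
  [ffun x : simplex d.+1 N => mpoch (fun i => y i + (x i)%:R) b].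

Lemma mrising_monic N (y : 'I_d.+1 -> R) : monic_family (mrising N y).
Proof.
split=> [|b i]; first by apply/ffunP=> x; rewrite !ffunE mpoch0.
exists (y i + (b i)%:R); apply/ffunP=> x.
by rewrite !ffunE mpochD mpochU mulrC addrCA addrA.
Qed.

(** Since $\mathrm m_a(x)/a! = \prod_i \binom{x_i}{a_i}$, this is $\binom{N}{m}$ times the mean of
    [f] over samples of size [m] drawn without replacement from [x], when $m \le N$. *)
Definition sampling m N (f : latfun R d m) : latfun R d N :=
  \sum_(a : simplex d.+1 m) (f a / (mfact a)%:R) *: mfun R N a.

Fact sampling_is_linear m N : linear (@sampling m N).
Proof.
move=> c f g; rewrite scaler_sumr -big_split /=; apply: eq_bigr => a _.
by rewrite !ffunE scalerA -scalerDl mulrDl mulrA.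
Qed.

HB.instance Definition _ (m N : nat) :=
  GRing.isLinear.Build R (latfun R d m) (latfun R d N) _ (@sampling m N)
    (@sampling_is_linear m N).

(** For $k \le m \le N$ this is $\binom{N-k}{m-k}$, in the form that Chu-Vandermonde yields. *)
Definition sampling_coef m N k : R :=
  (-1) ^+ (m - k) * poch (- N%:R + k%:R) (m - k) / ((m - k)`!)%:R.

Lemma sampling_mfun m N b : (mdeg b <= m)%N ->
  sampling N (mfun R m b) = sampling_coef m N (mdeg b) *: mfun R N b.
Proof.
move=> le_bm; apply/ffunP=> x; rewrite sum_ffunE [RHS]ffunE.
pose z i : R := (simplex_mnm x i)%:R.
transitivity (\sum_(a : simplex d.+1 m)
  mfalling b (fun i => (simplex_mnm a i)%:R) / (mfact a)%:R * mfalling a z).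
  by apply: eq_bigr => a _; rewrite !ffunE.
rewrite (sum_mfalling (fun a => mfalling a z) (esym (subnKC le_bm))).
transitivity (\sum_(y : simplex d.+1 (m - mdeg b)) (-1) ^+ m * mpoch (fun i => - z i) b *
    (mpoch (fun i => - z i + (b i)%:R) y / (mfact y)%:R)).
  apply: eq_bigr => y _.
  by rewrite /mfalling mpochD mdegD mdeg_simplex subnKC // !mulrA.
(* The parameters $b_i - x_i$ add up to $|b| - N$, so the sum depends on [b] only through its
   degree. *)
rewrite -mulr_sumr sum_mpoch big_split /= sumrN -!natr_sum -!mdegE mdeg_simplex.
rewrite ffunE /sampling_coef -[in X in X * _ * _ = _](subnKC le_bm) exprD.
by rewrite [RHS]mulrC -!mulrA; congr (_ * _); rewrite [RHS]mulrCA.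
Qed.

Lemma sampling_polyspace m N k (f : latfun R d m) : (k <= m.+1)%N ->
  f \in polyspace R d m k -> sampling N f \in polyspace R d N k.
Proof.
move=> le_km; rewrite -[sampling N f](lfunE (@sampling m N)) memv_preim.
apply/subvP: f; apply: monic_span (mfun_monic m) _ => b lt_bk.
rewrite -memv_preim lfunE /= sampling_mfun; last by rewrite -ltnS (leq_trans lt_bk).
rewrite memvZ //; apply: (subvP (polyspaceS _ _ _ lt_bk)).
exact: monic_mem (mfun_monic N).
Qed.

Variable kappa : 'I_d.+1 -> R.
Hypothesis kappa_gt : forall i, -1 < kappa i.

Lemma poch_gt0 (a : R) n : 0 < a -> 0 < poch a n.
Proof. by move=> a0; apply: prodr_gt0 => i _; rewrite ltr_wpDr ?ler0n. Qed.

Lemma kappa1_gt0 i : 0 < kappa1 kappa i.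
Proof. by rewrite /kappa1 -ltrBlDr sub0r. Qed.

Lemma mpoch_kappa1_neq0 b : mpoch (kappa1 kappa) b != 0.
Proof. by rewrite gt_eqF //; apply: prodr_gt0 => i _; apply/poch_gt0/kappa1_gt0. Qed.

Lemma sum_kappa1 : \sum_i kappa1 kappa i = ksum kappa + d.+1%:R.
Proof. by rewrite big_split /= sumr_const card_ord. Qed.

Lemma ksum_gt0 : 0 < ksum kappa + d.+1%:R.
Proof.
rewrite -sum_kappa1 big_ord_recl ltr_wpDr ?kappa1_gt0 // sumr_ge0 // => i _.
exact/ltW/kappa1_gt0.
Qed.

(** Up to a constant depending on [N], [m] and [kappa], for $m \le N$: the mean of [f] at the end of
    [N] draws from a Pólya urn with initial weights $\kappa + \mathbf 1$, given the counts [a] of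
    the first [m] draws. *)
Definition urn N m (f : latfun R d N) : latfun R d m :=
  [ffun a : simplex d.+1 m =>
     hahn_dot kappa f (mfun R N a) / mpoch (kappa1 kappa) a].

Fact urn_is_linear N m : linear (@urn N m).
Proof.
move=> c f g; apply/ffunP=> a; rewrite !ffunE hahn_dotPl mulrDl.
by rewrite -mulrA.
Qed.

HB.instance Definition _ (N m : nat) :=
  GRing.isLinear.Build R (latfun R d N) (latfun R d m) _ (@urn N m)
    (@urn_is_linear N m).

Definition urn_coef N m k : R :=
  (N`!)%:R / poch (ksum kappa + d.+1%:R) N *
  (poch (ksum kappa + d.+1%:R + (m + k)%:R) (N - m) / ((N - m)`!)%:R).

Lemma urn_mrising N m b : (m <= N)%N ->
  urn m (mrising N (kappa1 kappa) b) = urn_coef N m (mdeg b) *: mrising m (kappa1 kappa) b.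
Proof.
move=> le_mN; apply/ffunP=> a; rewrite [LHS]ffunE [RHS]ffunE [in RHS]ffunE /hahn_dot.
have -> (c e : R) : c *: (e : R^o) = c * e by [].
move: (simplex_mnm a) (mdeg_simplex a) => {}a am; have nz := mpoch_kappa1_neq0 a.
rewrite -[LHS]mulrA -[RHS]mulrA; congr (_ * _).
apply: (canLR (mulfK nz)).
transitivity (\sum_(x : simplex d.+1 N) mfalling a (fun i => (simplex_mnm x i)%:R)
    / (mfact x)%:R * mpoch (kappa1 kappa) (simplex_mnm x + b)%MM).
  by apply: eq_bigr => x _; rewrite !ffunE mpochD /mfalling; ring.
have eN : N = (mdeg a + (N - m))%N by rewrite am subnKC.
rewrite (sum_mfalling (fun x => mpoch (kappa1 kappa) (x + b)%MM) eN).
(* $(\kappa+\mathbf 1)_{a+b+y}$ splits off [a], then [b], then [y]; only the last factor is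
   summed. *)
transitivity (\sum_(y : simplex d.+1 (N - m)) mpoch (kappa1 kappa) a *
    mpoch (fun i => kappa1 kappa i + (a i)%:R) b *
    (mpoch (fun i => kappa1 kappa i + (a i)%:R + (b i)%:R) y / (mfact y)%:R)).
  by apply: eq_bigr => y _; rewrite -addmA (addmC _ b) mpochD mpochD !mulrA.
rewrite -mulr_sumr sum_mpoch big_split /= big_split /= -!natr_sum -!mdegE sum_kappa1 am.
by rewrite natrD addrA; ring.
Qed.

Lemma sampling_urn m n N (f : latfun R d N) : (n <= m)%N -> (m <= N)%N ->
  f \in polyspace R d N n.+1 ->
  sampling N (urn m f) - (urn_coef N m n * sampling_coef m N n) *: f
    \in polyspace R d N n.
Proof.
move=> le_nm le_mN; set lam := fun k => urn_coef N m k * sampling_coef m N k.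
(* As the claim says that a linear map sends one subspace into another, it suffices to check it on a
   monic family. *)
pose T := (linfun (@sampling m N) \o linfun (@urn N m) - lam n *: \1)%VF.
have TE g : T g = sampling N (urn m g) - lam n *: g.
  by rewrite add_lfunE opp_lfunE scale_lfunE id_lfunE comp_lfunE !lfunE.
rewrite -/(lam n) -TE memv_preim.
apply/subvP: f; apply: monic_span (mrising_monic N (kappa1 kappa)) _ => b.
rewrite ltnS -memv_preim TE => le_bn; set g := mrising N _ b.
have bE : sampling N (urn m g) - lam (mdeg b) *: g \in polyspace R d N (mdeg b).
  rewrite urn_mrising // linearZ /lam /= -scalerA -scalerBr memvZ //.
  (* [urn] yields a rising family and [sampling] is diagonal on the falling one; each exchange of
     the two costs only terms of degree below $|b|$. *)
  rewrite -(subrK (mfun R m b) (mrising m _ b)) linearD /=.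
  rewrite sampling_mfun ?(leq_trans le_bn) // -addrA -scalerBr memvD //.
    apply: sampling_polyspace; first exact: leq_trans le_bn (leqW le_nm).
    exact: monic_sub (mrising_monic m _) (mfun_monic m).
  rewrite memvZ //; exact: monic_sub (mfun_monic N) (mrising_monic N _).
(* For $|b| < n$ the scalar differs from [lam n], but [g] itself then has degree below [n]. *)
move: le_bn; rewrite leq_eqVlt => /predU1P[<- //|lt_bn].
rewrite -(subrK (lam (mdeg b) *: g) (sampling N _)) -addrA memvD //.
  exact: (subvP (polyspaceS _ _ _ (ltnW lt_bn))).
rewrite -scalerBl memvZ //; apply: (subvP (polyspaceS _ _ _ lt_bn)).
exact: monic_mem (mrising_monic N _).
Qed.

(** After splitting $(A)_{N+n}$ at $m+n$ and writing $(-m)_n$ and $(-N)_m$ as signed quotients of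
    factorials, everything cancels except $((-1)^n)^{-2}$. *)
Lemma hahnD_coef n m N : (n <= m)%N -> (m <= N)%N ->
  hahnD N kappa n m * (urn_coef N m n * sampling_coef m N n) = 1.
Proof.
move=> le_nm le_mN; rewrite /hahnD /urn_coef /sampling_coef.
set A := ksum kappa + _; have pA k : poch A k != 0 by rewrite gt_eqF ?poch_gt0 ?ksum_gt0.
have nzf k : (k`!)%:R != 0 :> R by rewrite pnatr_eq0 -lt0n fact_gt0.
have pochN p q : (q <= p)%N ->
    poch (- p%:R) q = (-1) ^+ q * (p`!)%:R / ((p - q)`!)%:R :> R.
  by move=> le_qp; rewrite -{2}(subnK le_qp) -pochN_fact subnK // mulrC mulKf.
have := pochD A (m + n) (N - m); rewrite addnAC subnKC // => ->.
have /esym := pochD (- N%:R : R) n (m - n); rewrite subnKC // => e.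
have nzN : poch (- N%:R : R) n != 0.
  by rewrite pochN ?(leq_trans le_nm) // !mulf_neq0 ?invr_eq0 ?signr_eq0.
have -> : poch (- N%:R + n%:R : R) (m - n) = poch (- N%:R) m / poch (- N%:R) n.
  by rewrite -e mulrC mulKf.
have nzA : poch (A + (m + n)%:R) (N - m) != 0.
  by rewrite gt_eqF // poch_gt0 // ltr_wpDr ?ler0n ?ksum_gt0.
rewrite (pochN m n) // (pochN N m) //.
have -> : (-1) ^+ m = (-1) ^+ n * (-1) ^+ (m - n) :> R by rewrite -exprD subnKC.
have := signr_eq0 R (m - n); have := signr_eq0 R n; have := sqrr_sign R n.
move: ((-1) ^+ n) ((-1) ^+ (m - n)) => s t s2 /negbT s0 /negbT t0.
transitivity ((s ^+ 2)^-1); last by rewrite s2 invr1.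
by field; rewrite s0 t0 nzN nzA !pA !nzf.
Qed.

End RaisingLowering.

(** * Orthogonal projection on $\mathcal V_n^d$ and the frame expansion *)

Section Projection.
Variables (R : realFieldType) (d N : nat) (kappa : 'I_d.+1 -> R).
Hypothesis kappa_gt : forall i, -1 < kappa i.
Implicit Types (f g h : latfun R d N) (V : {vspace latfun R d N}).

Lemma hahn_dot_sym f g : hahn_dot kappa f g = hahn_dot kappa g f.
Proof. by rewrite hahn_dotC expr0 mul1r. Qed.

Lemma hahn_dotPr f c g h :
  hahn_dot kappa f (c *: g + h) = c * hahn_dot kappa f g + hahn_dot kappa f h.
Proof. by rewrite hahn_dot_sym hahn_dotPl !(hahn_dot_sym f). Qed.

Lemma hahn_dotDr f g h :
  hahn_dot kappa f (g + h) = hahn_dot kappa f g + hahn_dot kappa f h.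
Proof. by rewrite -[g in LHS]scale1r hahn_dotPr mul1r. Qed.

Lemma hahn_dot0r f : hahn_dot kappa f 0 = 0.
Proof. by apply: (addrI (hahn_dot kappa f 0)); rewrite -hahn_dotDr !addr0. Qed.

Lemma hahn_dotZr f c g : hahn_dot kappa f (c *: g) = c * hahn_dot kappa f g.
Proof. by rewrite -[c *: g]addr0 hahn_dotPr hahn_dot0r addr0. Qed.

Lemma hahn_dot_proj V f g : f \in V ->
  hahn_dot kappa f (hahn_proj kappa V g) = hahn_dot kappa f g.
Proof.
move=> fV; have [_ /(_ f fV)] := hahn_projP kappa_gt V g.
rewrite hahn_dot_sym -scaleN1r hahn_dotDr hahn_dotZr mulN1r => /eqP.
by rewrite subr_eq0 => /eqP.
Qed.

Lemma hahn_proj_id V f : f \in V -> hahn_proj kappa V f = f.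
Proof.
move=> fV; have [PfV o] := hahn_projP kappa_gt V f.
apply/esym/eqP; rewrite -subr_eq0; apply/eqP.
by apply: (hahn_dot_eq0 kappa_gt); apply: o; apply: memvB.
Qed.

(** The projection $Pg$ is in $\mathcal V_n^d$, hence orthogonal to [g], so $\langle Pg, Pg\rangle =
    \langle Pg, g\rangle = 0$. *)
Lemma hahn_proj_polyspace n g : g \in polyspace R d N n ->
  hahn_proj kappa (hahnV N kappa n) g = 0.
Proof.
move=> gn; have [PgV _] := hahn_projP kappa_gt (hahnV N kappa n) g.
apply: (hahn_dot_eq0 kappa_gt); rewrite hahn_dot_proj //.
by have [_ ->] := (mem_hahnV kappa n _).1 PgV.
Qed.

Lemma hahn_dot_hahnQ n f (a : 'X_{1..d.+1}) : f \in hahnV N kappa n ->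
  hahn_dot kappa f (hahnQ N kappa n a) =
  (mpoch (kappa1 kappa) a)^-1 * hahn_dot kappa f (mfun R N a).
Proof. by move=> fV; rewrite hahn_dotZr hahn_dot_proj. Qed.

Lemma hahnQ_frame n m f : (n <= m)%N -> (m <= N)%N -> f \in hahnV N kappa n ->
  f = hahnD N kappa n m *: \sum_(a : simplex d.+1 m)
    (mpoch (kappa1 kappa) a / (mfact a)%:R * hahn_dot kappa f (hahnQ N kappa n a)) *:
    hahnQ N kappa n a.
Proof.
move=> le_nm le_mN fV; have [fn _] := (mem_hahnV kappa n f).1 fV.
(* Projecting the congruence of [sampling_urn] makes it an equality, since [f] is its own
   projection. *)
have := hahn_proj_polyspace (sampling_urn kappa_gt le_nm le_mN fn).
rewrite linearB linearZ /= (hahn_proj_id fV) => /eqP; rewrite subr_eq0 => /eqP e.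
rewrite -{1}[f]scale1r -[1 in LHS](hahnD_coef kappa_gt le_nm le_mN) -scalerA -e.
(* The projection enters the sum and turns each $\mathrm m_a$ into $(\kappa+\mathbf 1)_a \mathsf
   Q_{a,n}$. *)
congr (_ *: _); rewrite /sampling linear_sum; apply: eq_bigr => a _.
rewrite linearZ /= {2}/hahnQ scalerA ffunE hahn_dot_hahnQ //; congr (_ *: _).
have := mpoch_kappa1_neq0 kappa_gt (simplex_mnm a); have := mfact_neq0 R (simplex_mnm a) => u v.
by field; rewrite u v.
Qed.

End Projection.

Theorem theorem5p1 (R : realFieldType) (d n m N : nat) (kappa : 'I_d.+1 -> R)
  (d_ge1 : (1 <= d)%N) (le_nm : (n <= m)%N) (le_mN : (m <= N)%N)
  (kappa_gt : forall i, -1 < kappa i) :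
  (forall f : latfun R d N, f \in hahnV N kappa n ->
     forall x : simplex d.+1 N,
       f x = hahnD N kappa n m *
         \sum_(a : simplex d.+1 m)
            mpoch (kappa1 kappa) a / (mfact a)%:R
              * hahn_dot kappa f (hahnQ N kappa n a)
              * hahnQ N kappa n a x)
  /\
  (forall f : latfun R d N, f \in hahnV N kappa n ->
     hahn_dot kappa f f = hahnD N kappa n m *
       \sum_(a : simplex d.+1 m)
          mpoch (kappa1 kappa) a / (mfact a)%:R
            * (hahn_dot kappa f (hahnQ N kappa n a)) ^+ 2).
Proof.
have frame (f : latfun R d N) := hahnQ_frame kappa_gt (f := f) le_nm le_mN.
split=> f fV => [x|].
  rewrite {1}(frame f fV) ffunE sum_ffunE; congr (_ * _).
  by apply: eq_bigr => a _; rewrite ffunE.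
(* Expanding only the second argument leaves one factor $\langle f, \mathsf Q_{a,n}\rangle$ from the
   coefficient and one from the product. *)
rewrite {2}(frame f fV) hahn_dotZr; congr (_ * _).
rewrite (big_morph _ (hahn_dotDr kappa f) (hahn_dot0r kappa f)).
by apply: eq_bigr => a _; rewrite hahn_dotZr expr2 [RHS]mulrA.
Qed.
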